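(* Let $G$ be a finitely generated $2$-step nilpotent group having a centralizer-small element. Then the largest ring of scalars of $G$ is isomorphic to the ring of integers $\mathbb Z$.
   Context: $Z(G)$ is the center, $G'=[G,G]$, and $C_G(g)$ is the centralizer of $g$. An element $g\in G$ is centralizer-small (c-small) if $C_G(g)/Z(G)$ is infinite cyclic generated by $gZ(G)$. A ring of scalars of a finitely generated $2$-step nilpotent group $G$ is a commutative associative ring $R$ with identity that acts faithfully by endomorphisms on the abelian groups $G/Z(G)$ and $G'$ in such a way that the commutator map $[\cdot,\cdot]:G/Z(G)\times G/Z(G)\to G'$, $(gZ(G),hZ(G))\mapsto[g,h]$, is $R$-bilinear with respect to these actions. Any ring of scalars $R$ of $G$ embeds in $\operatorname{End}(G/Z(G))$ and is identified with its image there. A ring of scalars $R$ of $G$ is called a largest ring of scalars if $K\le R\le\operatorname{End}(G/Z(G))$ for every ring of scalars $K$ of $G$. *)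

(* Defs.v *)
From HB Require Import structures.
From mathcomp Require Import all_boot all_algebra.
From mathcomp Require Import boolp classical_sets.

Set Implicit Arguments.
Unset Strict Implicit.
Unset Printing Implicit Defensive.

Import GRing.Theory.
Local Open Scope classical_set_scope.
Local Open Scope quotient_scope.
Local Open Scope group_scope.

Section Groups.
Variable G : groupType.
Implicit Types (A : set G) (g x y : G).

Definition generated A : set G :=
  smallest (fun H : set G => group_closed [in H]) A.

Definition finitely_generated : Prop :=
  exists s : seq G, generated [set` s] = setT.

Definition center : set G := [set z | forall x, commute z x].

Definition centralizer g : set G := [set x | commute x g].

Definition derived : set G := generated [set [~ x, y] | x in setT & y in setT].

Lemma group_closed_generated A : group_closed [in generated A].
Proof.
split; first by apply/mem_set => H [[H1 _] _]; exact: set_mem.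
move=> x y /set_mem gx /set_mem gy; apply/mem_set => H [gH sAH].
by apply/set_mem/gH.2; apply/mem_set; [apply: gx | apply: gy].
Qed.

Lemma sub_generated A : A `<=` generated A.
Proof. exact: sub_gen_smallest. Qed.

Lemma derived_commg x y : derived [~ x, y].
Proof. by apply: sub_generated; exists x => //; exists y. Qed.

Lemma group_closed_center : group_closed [in center].
Proof.
split; first by apply/mem_set => x; exact: commute_sym (commute1 x).
move=> x y /set_mem cx /set_mem cy; apply/mem_set => z.
by apply/commute_sym/commuteM; [|apply: commuteV]; exact/commute_sym.
Qed.

End Groups.

Arguments finitely_generated : clear implicits.
Arguments center : clear implicits.
Arguments derived : clear implicits.

(* Nilpotency class exactly 2. *)
HB.mixin Record isTwoStepNilpotent G of Group G := {
  derived_sub_center : derived G `<=` center G;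
  derived_neq1 : derived G <> [set 1]
}.

#[short(type="nil2GroupType")]
HB.structure Definition Nil2Group := {G of Group G & isTwoStepNilpotent G}.

Notation endo V := {additive V -> V}.

Section Endomorphisms.
Variable V : zmodType.
Local Open Scope ring_scope.
Implicit Types f g h : endo V.

HB.instance Definition _ := gen_eqMixin (endo V).
HB.instance Definition _ := gen_choiceMixin (endo V).

Lemma endoP f g : f =1 g -> f = g.
Proof.
case: f g => [f [[cf]]] [g [[cg]]] /= /funext fg.
by subst g; rewrite (Prop_irrelevance cf cg).
Qed.

Definition endo_zero : endo V := \0.
Definition endo_one : endo V := idfun.
Definition endo_opp f : endo V := \- f.
Definition endo_add f g : endo V := f \+ g.
Definition endo_mul f g : endo V := f \o g.

Fact endo_addA : associative endo_add.
Proof. by move=> f g h; apply: endoP => x; exact: addrA. Qed.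
Fact endo_addC : commutative endo_add.
Proof. by move=> f g; apply: endoP => x; exact: addrC. Qed.
Fact endo_add0 : left_id endo_zero endo_add.
Proof. by move=> f; apply: endoP => x; exact: add0r. Qed.
Fact endo_addN : left_inverse endo_zero endo_opp endo_add.
Proof. by move=> f; apply: endoP => x; exact: addNr. Qed.

HB.instance Definition _ := GRing.isZmodule.Build (endo V)
  endo_addA endo_addC endo_add0 endo_addN.

Fact endo_mulA : associative endo_mul.
Proof. by move=> f g h; apply: endoP. Qed.
Fact endo_mul1l : left_id endo_one endo_mul.
Proof. by move=> f; apply: endoP. Qed.
Fact endo_mul1r : right_id endo_one endo_mul.
Proof. by move=> f; apply: endoP. Qed.
Fact endo_mulDl : left_distributive endo_mul endo_add.
Proof. by move=> f g h; apply: endoP. Qed.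
Fact endo_mulDr : right_distributive endo_mul endo_add.
Proof. by move=> f g h; apply: endoP => x; exact: raddfD. Qed.

HB.instance Definition _ := GRing.Zmodule_isPzRing.Build (endo V)
  endo_mulA endo_mul1l endo_mul1r endo_mulDl endo_mulDr.

Lemma endo0E x : (0 : endo V) x = 0. Proof. by []. Qed.
Lemma endoDE f g x : (f + g) x = f x + g x. Proof. by []. Qed.
Lemma endoNE f x : (- f) x = - f x. Proof. by []. Qed.
Lemma endo1E x : (1 : endo V) x = x. Proof. by []. Qed.
Lemma endoME f g x : (f * g) x = f (g x). Proof. by []. Qed.

End Endomorphisms.

Section CentralQuotient.
Variable G : nil2GroupType.
Implicit Types x y z : G.

Lemma commg_center x y z : commute [~ x, y] z.
Proof. exact: (derived_sub_center _ (derived_commg x y)). Qed.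

Definition center_rel x y : bool := `[< center G (x^-1 * y) >].

Fact center_rel_equiv : equiv_class_of center_rel.
Proof.
have [Z1 ZB] := group_closed_center G.
have ZV := group_closedV (conj Z1 ZB); have ZM := group_closedM (conj Z1 ZB).
split=> [x|x y|y x z].
- by apply/asboolP; rewrite mulVg; apply/set_mem.
- by apply/asboolP/asboolP => /mem_set /ZV /set_mem; rewrite invgM invgK.
- move=> /asboolP/mem_set xy /asboolP/mem_set yz; apply/asboolP/set_mem.
  by rewrite -[z](mulVKg y) mulgA ZM.
Qed.

Canonical center_equiv := EquivRelPack center_rel_equiv.

(* G/Z(G), written additively: it is abelian since G' <= Z(G). *)
Definition central_quotient := {eq_quot center_equiv}.
HB.instance Definition _ := Choice.on central_quotient.
HB.instance Definition _ := EqQuotient.on central_quotient.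
Local Notation Q := central_quotient.

Lemma central_quotient_eqP x y :
  \pi_Q x = \pi_Q y <-> center G (x^-1 * y).
Proof. by split=> [/eqmodP/asboolP|?]; last by apply/eqmodP/asboolP. Qed.

Fact central_quotient_mul x1 x2 y1 y2 : \pi_Q x1 = \pi_Q x2 ->
  \pi_Q y1 = \pi_Q y2 -> \pi_Q (x1 * y1) = \pi_Q (x2 * y2).
Proof.
move=> /central_quotient_eqP x12 /central_quotient_eqP y12.
apply/central_quotient_eqP.
have xy : x1^-1 * x2 * y1^-1 = y1^-1 * (x1^-1 * x2) by exact: x12.
have -> : (x1 * y1)^-1 * (x2 * y2) = (x1^-1 * x2) * (y1^-1 * y2).
  by rewrite [RHS]mulgA xy invgM !mulgA.
by apply/set_mem/(group_closedM (group_closed_center G)); exact/mem_set.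
Qed.

Definition cq_zero : Q := \pi_Q 1.
Definition cq_opp (a : Q) : Q := \pi_Q (repr a)^-1.
Definition cq_add (a b : Q) : Q := \pi_Q (repr a * repr b).

Fact cq_addE x y : cq_add (\pi_Q x) (\pi_Q y) = \pi_Q (x * y).
Proof. by apply: central_quotient_mul; rewrite reprK. Qed.

Fact cq_addA : associative cq_add.
Proof.
move=> a b c; rewrite -(reprK a) -(reprK b) -(reprK c).
rewrite (cq_addE (repr b) (repr c)) (cq_addE (repr a) (repr b)).
by rewrite !cq_addE mulgA.
Qed.

Fact cq_addC : commutative cq_add.
Proof.
move=> a b; apply/central_quotient_eqP; rewrite invgM -mulgA.
exact: (derived_sub_center _ (derived_commg (repr b) (repr a))).
Qed.

Fact cq_add0 : left_id cq_zero cq_add.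
Proof. by move=> a; rewrite -[in LHS](reprK a) cq_addE mul1g reprK. Qed.

Fact cq_addN : left_inverse cq_zero cq_opp cq_add.
Proof. by move=> a; rewrite -[X in cq_add _ X](reprK a) cq_addE mulVg. Qed.

HB.instance Definition _ :=
  GRing.isZmodule.Build Q cq_addA cq_addC cq_add0 cq_addN.

Lemma pi_mulg x y : \pi_Q (x * y) = (\pi_Q x + \pi_Q y)%R.
Proof. by rewrite -cq_addE. Qed.

(* G' as a type, written additively: it is abelian since G' <= Z(G). *)
Record commutator_subgroup := CommutatorSubgroup {
  derived_val :> G;
  derived_valP : derived_val \in derived G }.
Local Notation D := commutator_subgroup.

HB.instance Definition _ := [isSub for derived_val].
HB.instance Definition _ := [Choice of D by <:].

Let derivedG : group_closed [in derived G] := group_closed_generated _.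

Definition cs_zero : D := CommutatorSubgroup derivedG.1.
Definition cs_opp (a : D) : D :=
  CommutatorSubgroup (group_closedV derivedG (derived_valP a)).
Definition cs_add (a b : D) : D :=
  CommutatorSubgroup (group_closedM derivedG (derived_valP a) (derived_valP b)).

Fact cs_addA : associative cs_add.
Proof. by move=> a b c; apply: val_inj; exact: mulgA. Qed.
Fact cs_addC : commutative cs_add.
Proof.
by move=> a b; apply: val_inj; exact: (derived_sub_center _ (set_mem (valP a))).
Qed.
Fact cs_add0 : left_id cs_zero cs_add.
Proof. by move=> a; apply: val_inj; exact: mul1g. Qed.
Fact cs_addN : left_inverse cs_zero cs_opp cs_add.
Proof. by move=> a; apply: val_inj; exact: mulVg. Qed.

HB.instance Definition _ :=
  GRing.isZmodule.Build D cs_addA cs_addC cs_add0 cs_addN.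

Lemma derived_valD (a b : D) : derived_val (a + b)%R = derived_val a * derived_val b.
Proof. by []. Qed.

Fact mem_derived_commg x y : [~ x, y] \in derived G.
Proof. by apply/mem_set; exact: derived_commg. Qed.

(* The map G/Z(G) x G/Z(G) -> G', (xZ(G), yZ(G)) |-> [x, y]; that it does not
   depend on representatives is commutator_mapE. *)
Definition commutator_map (a b : Q) : D :=
  CommutatorSubgroup (mem_derived_commg (repr a) (repr b)).

Fact commg_mul_center x y z : center G z -> [~ x * z, y] = [~ x, y].
Proof.
move=> cz; apply: (mulgI (y * (x * z))); rewrite -commgC.
have -> : x * z * y = y * x * [~ x, y] * z.
  have zy : z * y = y * z by exact: cz.
  by rewrite -(mulgA x) zy mulgA (commgC x y).
have zc : z * [~ x, y] = [~ x, y] * z by exact: cz.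
by rewrite -(mulgA _ _ z) -zc !mulgA.
Qed.

Lemma commutator_mapE x y :
  derived_val (commutator_map (\pi_Q x) (\pi_Q y)) = [~ x, y].
Proof.
have e u v w : \pi_Q u = \pi_Q v -> [~ u, w] = [~ v, w].
  move=> /central_quotient_eqP uv.
  by rewrite -[v](mulVKg u) commg_mul_center.
rewrite /= (e _ x _ (reprK _)) -[LHS]invgK invgR.
by rewrite (e _ y _ (reprK _)) invgR.
Qed.

(* C_G(g)/Z(G) is the infinite cyclic group generated by gZ(G). *)
Definition centralizer_small (g : G) : Prop :=
  \pi_Q @` centralizer g = range (fun n : int => (\pi_Q g *~ n)%R) /\
  injective (fun n : int => (\pi_Q g *~ n)%R).

End CentralQuotient.

Arguments central_quotient : clear implicits.
Arguments commutator_subgroup : clear implicits.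

Section ScalarRings.
Variable G : nil2GroupType.
Local Open Scope ring_scope.
Local Notation Q := (central_quotient G).
Local Notation D := (commutator_subgroup G).

Definition bilinear_wrt (R : comPzRingType)
    (aQ : R -> endo Q) (aD : R -> endo D) (b : Q -> Q -> D) : Prop :=
  [/\ forall x x' y, b (x + x') y = b x y + b x' y,
      forall x y y', b x (y + y') = b x y + b x y',
      forall r x y, b (aQ r x) y = aD r (b x y)
    & forall r x y, b x (aQ r y) = aD r (b x y)].

Record scalar_ring := ScalarRing {
  scalar_carrier :> comPzRingType;
  quotient_action : {rmorphism scalar_carrier -> endo Q};
  derived_action : {rmorphism scalar_carrier -> endo D};
  quotient_action_faithful : injective quotient_action;
  derived_action_faithful : injective derived_action;
  commutator_bilinear :
    bilinear_wrt quotient_action derived_action (@commutator_map G)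
}.

(* Rings of scalars are compared through their images in End(G/Z(G)). *)
Definition largest_scalar_ring (R : scalar_ring) : Prop :=
  forall K : scalar_ring,
    range (@quotient_action K) `<=` range (@quotient_action R).

End ScalarRings.

Definition ring_isomorphic (R S : pzRingType) : Prop :=
  exists f : {rmorphism R -> S}, bijective f.

(* Main.v *)
Require Import Defs.
From HB Require Import structures.
From mathcomp Require Import all_boot all_algebra.
From mathcomp Require Import boolp classical_sets.

(** Write [Q] for [G/Z(G)] and [b : Q x Q -> G'] for the commutator form, which
is biadditive and alternating and has trivial radical.  If [g] is c-small and
[a] is its image in [Q], then [b a x = 0] exactly when [x] is an integer
multiple of [a], and [a] has infinite order.

These properties force every scalar to act on [Q] as an integer
(lemma [adjoint_scalar]).  Let a scalar act as [s] on [Q] and as [t] on [G'].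
Since [b (s a) a = t (b a a) = 0], we get [s a = n a] for some integer [n].
For any [y], [b a (s y) = b (s a) y = b a (n y)], so [s y = n y + k a] for some
integer [k].  Comparing [b (s y) y] with [b y (s y)] gives [2 k b a y = 0], so
[2 k y = m a] for some [m]; applying [s - n], which kills [a], gives
[2 k^2 a = 0], whence [k = 0].

Conversely the integers do form a ring of scalars (lemma [int_scalar_ring]):
they act faithfully on [Q] because [a] has infinite order, and on [G'] because
an integer killing [G'] sends [a] into the radical of [b].  So the image in
[End Q] of every ring of scalars is the ring of integer multiplications. *)

Set Implicit Arguments.
Unset Strict Implicit.
Unset Printing Implicit Defensive.

Import GRing.Theory Num.Theory.
Local Open Scope classical_set_scope.
Local Open Scope quotient_scope.
Local Open Scope ring_scope.

Lemma additive_mulrz (V W : zmodType) (f : V -> W) :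
  {morph f : x y / x + y} -> forall n, {morph f : x / x *~ n}.
Proof.
move=> fD; have f0 : f 0 = 0 by apply: (addrI (f 0)); rewrite -fD !addr0.
have fN x : f (- x) = - f x by apply: (addrI (f x)); rewrite -fD !subrr.
have fB : zmod_morphism f by move=> x y; rewrite fD fN.
pose F : {additive V -> W} := HB.pack f (GRing.isZmodMorphism.Build V W f fB).
by move=> n x; exact: (raddfMz F).
Qed.

Lemma endo_intE (V : zmodType) (n : int) (x : V) :
  (n%:~R : endo V) x = x *~ n.
Proof. by rewrite (@additive_mulrz _ _ (fun f : endo V => f x)). Qed.

(** An endomorphism that can be moved across an alternating form is an integer
as soon as some element [a] of infinite order is orthogonal only to its own
integer multiples.  The map [t] on the values of the form is what gives
[b (s a) a = 0]; self-adjointness of [s] would only give [2 b (s a) a = 0]. *)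
Lemma adjoint_scalar (V W : zmodType) (b : V -> V -> W) (a : V)
    (s : endo V) (t : endo W) :
  (forall x x' y, b (x + x') y = b x y + b x' y) ->
  (forall x y y', b x (y + y') = b x y + b x y') ->
  (forall x, b x x = 0) ->
  injective (fun n : int => a *~ n) ->
  (forall x, b a x = 0 -> exists n : int, x = a *~ n) ->
  (forall x y, b (s x) y = t (b x y)) ->
  (forall x y, b x (s y) = t (b x y)) ->
  exists n : int, s = n%:~R.
Proof.
move=> bDl bDr bxx a_inj a_orth sl sr.
have bMl n x y : b (x *~ n) y = b x y *~ n.
  by apply: (@additive_mulrz _ _ (b^~ y)) => u v; exact: bDl.
have bMr n x y : b x (y *~ n) = b x y *~ n.
  by apply: (@additive_mulrz _ _ (b x)) => u v; exact: bDr.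
have bC x y : b y x = - b x y.
  have := bxx (x + y); rewrite bDl !bDr !bxx add0r addr0.
  by move/eqP; rewrite addrC addr_eq0 => /eqP.
have [|n san] := a_orth (s a); first by rewrite sr bxx raddf0.
exists n; apply: endoP => y; rewrite endo_intE.
have [|k syk] := a_orth (s y - y *~ n).
  by rewrite bDr -mulrNz bMr sr -sl san bMl mulrNz subrr.
have {}syk : s y = y *~ n + a *~ k by rewrite -syk addrC subrK.
(* The two ways of moving s across b y y differ by 2k b a y, as b y a = - b a y. *)
have [|m ykm] := a_orth (y *~ (k + k)).
  have : b (s y) y = b y (s y) by rewrite sl sr.
  rewrite syk bDl bDr !bMl !bMr bxx mul0rz !add0r (bC a y) => /eqP.
  by rewrite mulNrz -addr_eq0 -mulrzDr -bMr => /eqP.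
(* Applying s to both sides of ykm, the contributions of n cancel. *)
have : a *~ (k * (k + k)) = a *~ 0.
  have := congr1 s ykm; rewrite !raddfMz syk san mulrzDl mulrzAC ykm.
  rewrite [a *~ n *~ m]mulrzAC mulrzA mulr0z => e.
  by apply: (addrI (a *~ m *~ n)); rewrite addr0.
move/a_inj/eqP; rewrite mulf_eq0 -mulr2n mulrn_eq0 /= orbb => /eqP k0.
by rewrite syk k0 mulr0z addr0.
Qed.

Section CommutatorForm.
Variable G : nil2GroupType.
Local Notation Q := (central_quotient G).
Local Notation D := (commutator_subgroup G).
Local Notation b := (@commutator_map G).

Lemma derived_val_inj : injective (@derived_val G).
Proof. exact: val_inj. Qed.

Lemma commutator_map_eq0 (x y : G) :
  b (\pi_Q x) (\pi_Q y) = 0 <-> commute x y.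
Proof.
split=> [bxy0|/commgP/eqP xy1].
  by apply/commgP/eqP; rewrite -commutator_mapE bxy0.
by apply: derived_val_inj; rewrite commutator_mapE xy1.
Qed.

Lemma commutator_mapxx (x : Q) : b x x = 0.
Proof. by rewrite -(reprK x); apply/commutator_map_eq0; exact: commute_refl. Qed.

Lemma commutator_mapNC (x y : Q) : b y x = - b x y.
Proof.
by apply: derived_val_inj; rewrite -[RHS]/(_^-1)%g invgR.
Qed.

(** The identity [[xx', y] = [x, y]^x' [x', y]] is additivity once commutators
are central, since conjugation by [x'] then fixes [[x, y]]. *)
Lemma commutator_mapDl (x x' y : Q) : b (x + x') y = b x y + b x' y.
Proof.
rewrite -(reprK x) -(reprK x') -(reprK y) -pi_mulg.
move: (repr x) (repr x') (repr y) => {}x {}x' {}y.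
apply: derived_val_inj; rewrite derived_valD !commutator_mapE.
apply: (mulgI (y * (x * x'))%g); rewrite -commgC.
have xy := commgC x y; have x'y := commgC x' y.
have cx' : ([~ x, y] * x' = x' * [~ x, y])%g := commg_center x y x'.
move: [~ x, y]%g [~ x', y]%g xy x'y cx' => c c' xy x'y cx'.
by rewrite -(mulgA x x' y) x'y !mulgA xy -(mulgA (y * x)%g c x') cx' !mulgA.
Qed.

Lemma commutator_mapDr (x y y' : Q) : b x (y + y') = b x y + b x y'.
Proof.
by rewrite commutator_mapNC commutator_mapDl opprD -!commutator_mapNC.
Qed.

Lemma commutator_map_nondegenerate (x : Q) : (forall y, b x y = 0) -> x = 0.
Proof.
rewrite -(reprK x) => bx0; apply: esym; apply/central_quotient_eqP.
by rewrite invg1 mul1g => y; apply/commutator_map_eq0.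
Qed.

Lemma centralizer_small_orthogonal (g : G) (x : Q) : centralizer_small g ->
  b (\pi_Q g) x = 0 -> exists n : int, x = \pi_Q g *~ n.
Proof.
move=> [gE _]; rewrite -(reprK x) => /commutator_map_eq0 gx.
have : (\pi_Q @` centralizer g) (\pi_Q (repr x)).
  by exists (repr x) => //; exact: commute_sym.
by rewrite gE => -[n _ <-]; exists n.
Qed.

Lemma scalar_action_int (g : G) (R : scalar_ring G) (r : R) :
  centralizer_small g -> exists n : int, quotient_action R r = n%:~R.
Proof.
move=> gs; have [bDl bDr rl rr] := commutator_bilinear R.
apply: (adjoint_scalar (a := \pi_Q g) (t := derived_action R r) bDl bDr) => //.
- exact: commutator_mapxx.
- exact: gs.2.
- by move=> x; exact: centralizer_small_orthogonal.
Qed.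

Lemma int_bilinear :
  bilinear_wrt (intmul (1 : endo Q)) (intmul (1 : endo D)) b.
Proof.
split=> [||n x y|n x y]; rewrite ?endo_intE.
- exact: commutator_mapDl.
- exact: commutator_mapDr.
- apply: (@additive_mulrz _ _ (b^~ y)) => u v; exact: commutator_mapDl.
- apply: (@additive_mulrz _ _ (b x)) => u v; exact: commutator_mapDr.
Qed.

Lemma int_quotient_faithful (g : G) : centralizer_small g ->
  injective (intmul (1 : endo Q)).
Proof.
by move=> [_ g_inj] m n mn; apply: g_inj; rewrite /= -[LHS]endo_intE -[RHS]endo_intE mn.
Qed.

(** An integer [d] killing [G'] satisfies [b (d a) y = d (b a y) = 0] for all
[y], so [d a = 0] because the radical of [b] is trivial. *)
Lemma int_derived_faithful (g : G) : centralizer_small g ->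
  injective (intmul (1 : endo D)).
Proof.
move=> [_ g_inj] m n mn; apply: g_inj => /=; apply/eqP.
rewrite -subr_eq0 -mulrzBr; apply/eqP/commutator_map_nondegenerate => y.
have [_ _ bl _] := int_bilinear.
by rewrite -endo_intE bl rmorphB /= mn subrr.
Qed.

Lemma int_scalar_ring (g : G) : centralizer_small g ->
  exists R : scalar_ring G, forall n : int,
    exists r : R, quotient_action R r = n%:~R.
Proof.
move=> gs; exists (ScalarRing (quotient_action := intmul (1 : endo Q))
  (derived_action := intmul (1 : endo D)) (int_quotient_faithful gs)
  (int_derived_faithful gs) int_bilinear).
by move=> n; exists n.
Qed.

(** A ring of scalars embeds in [End Q] with image inside the integer
multiplications, and it contains all of these since it has an identity; the map
reading off the integer is therefore inverse to the canonical map from [int]. *)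
Lemma scalar_ring_iso_int (g : G) (R : scalar_ring G) :
  centralizer_small g -> ring_isomorphic R int.
Proof.
move=> gs; have [f fE] := choice (fun r : R => scalar_action_int r gs).
have intK : cancel (intmul (1 : R)) f.
  by move=> n; apply: (int_quotient_faithful gs); rewrite -fE rmorph_int.
have fK : cancel f (intmul (1 : R)).
  by move=> r; apply: (@quotient_action_faithful _ R); rewrite rmorph_int fE.
pose F : {rmorphism R -> int} := HB.pack f
  (GRing.isZmodMorphism.Build R int f (can2_zmod_morphism intK fK))
  (GRing.isMonoidMorphism.Build R int f (can2_monoid_morphism intK fK)).
by exists F; exists (intmul 1).
Qed.

End CommutatorForm.

Theorem theorem3p4 (G : nil2GroupType) :
  finitely_generated G ->
  (exists g : G, centralizer_small g) ->
  (exists R : scalar_ring G, largest_scalar_ring R) /\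
  (forall R : scalar_ring G, largest_scalar_ring R -> ring_isomorphic R int).
Proof.
move=> _ [g gs]; split; last by move=> R _; exact: scalar_ring_iso_int gs.
have [R RE] := int_scalar_ring gs; exists R => K _ [r _ <-].
have [n ->] := scalar_action_int r gs.
by have [z <-] := RE n; exists z.
Qed.
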